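(* Let $m\ge 2$, $n\ge 1$ and $\mathcal{A}\in T_{m,n}$. Then: (i) $\mathcal{A}$ is a strictly semi-positive tensor if and only if $\beta(\mathcal{A})>0$; (ii) $\beta(\mathcal{A})\ge 0$ if $\mathcal{A}$ is a semi-positive tensor.
   Context: $T_{m,n}$ is the set of real tensors $\mathcal{A}=(a_{i_1\cdots i_m})$ of order $m$ and dimension $n$, with indices in $I_n=\{1,\dots,n\}$ and no symmetry assumed. For $x\in\mathbb{R}^n$, $\mathcal{A}x^{m-1}\in\mathbb{R}^n$ has components $(\mathcal{A}x^{m-1})_i=\sum_{i_2,\dots,i_m=1}^n a_{ii_2\cdots i_m}x_{i_2}\cdots x_{i_m}$. Inequalities between vectors are componentwise. $\mathcal{A}$ is semi-positive (resp. strictly semi-positive) if for each $x\ge 0$, $x\ne 0$, there is $k\in I_n$ with $x_k>0$ and $(\mathcal{A}x^{m-1})_k\ge 0$ (resp. $(\mathcal{A}x^{m-1})_k>0$). $\beta(\mathcal{A}):=\min_{x\ge 0,\ \|x\|_\infty=1}\ \max_{i\in I_n}x_i(\mathcal{A}x^{m-1})_i$, where $\|x\|_\infty=\max_i|x_i|$. *)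

(* Defs.v *)
From mathcomp Require Import all_boot all_order all_algebra.
From mathcomp Require Import all_classical all_reals all_analysis.

Set Implicit Arguments.
Unset Strict Implicit.
Unset Printing Implicit Defensive.

Import Order.TTheory GRing.Theory Num.Theory.
Import numFieldNormedType.Exports.

Local Open Scope classical_set_scope.
Local Open Scope ring_scope.

(* Real tensors of order m and dimension n: one entry per multi-index
   (i_1, ..., i_m), with no symmetry imposed. *)
Definition tensor (R : realType) (m n : nat) : Type :=
  {ffun m.-tuple 'I_n -> R}.

(* A x^(m-1): its i-th component sums over the multi-indices t whose head i_1
   is i, the monomial x_(i_2) ... x_(i_m) being indexed by the tail of t. *)
Definition tensor_app (R : realType) (m n : nat) (A : tensor R m n)
    (x : 'rV[R]_n) : 'rV[R]_n :=
  \row_i \sum_(t : m.-tuple 'I_n | ohead t == Some i)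
    A t * \prod_(j <- behead t) x 0 j.

Definition vec_ge0 (R : realType) (n : nat) (x : 'rV[R]_n) : Prop :=
  forall i, 0 <= x 0 i.

Definition semi_positive (R : realType) (m n : nat) (A : tensor R m n) : Prop :=
  forall x : 'rV[R]_n, vec_ge0 x -> x != 0 ->
    exists k, 0 < x 0 k /\ 0 <= tensor_app A x 0 k.

Definition strictly_semi_positive (R : realType) (m n : nat)
    (A : tensor R m n) : Prop :=
  forall x : 'rV[R]_n, vec_ge0 x -> x != 0 ->
    exists k, 0 < x 0 k /\ 0 < tensor_app A x 0 k.

(* The dimension is n.+1 so that the maximum is over a nonempty index set; the
   iterated max starts from the ord0 term, not from 0, since all the terms may
   be negative. *)
Definition beta_fun (R : realType) (m n : nat) (A : tensor R m n.+1)
    (x : 'rV[R]_n.+1) : R :=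
  \big[Num.max/x 0 ord0 * tensor_app A x 0 ord0]_(i < n.+1)
    (x 0 i * tensor_app A x 0 i).

(* `|x| on matrices is the largest absolute value of an entry (mx_norm), that
   is, the infinity norm on row vectors. *)
Definition beta_dom (R : realType) (n : nat) : set 'rV[R]_n :=
  [set x | vec_ge0 x /\ `|x| = 1].

(* This infimum is a minimum: see beta_min. *)
Definition beta (R : realType) (m n : nat) (A : tensor R m n.+1) : R :=
  inf [set beta_fun A x | x in @beta_dom R n.+1].

Lemma prod_coord_continuous (R : realType) (n : nat) (s : seq 'I_n) :
  continuous (fun x : 'rV[R]_n => \prod_(j <- s) x 0 j).
Proof.
elim: s => [|j s IH].
  under eq_fun do rewrite big_nil.
  by move=> x; apply: cst_continuous.
under eq_fun do rewrite big_cons.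
by move=> x; apply: continuousM; [exact: coord_continuous|exact: IH].
Qed.

Lemma tensor_app_continuous (R : realType) (m n : nat) (A : tensor R m n)
  (i : 'I_n) : continuous (fun x : 'rV[R]_n => tensor_app A x 0 i).
Proof.
under eq_fun do rewrite mxE.
have c (r : seq (m.-tuple 'I_n)) : continuous (fun x : 'rV[R]_n =>
    \sum_(t <- r | ohead t == Some i) A t * \prod_(j <- behead t) x 0 j).
  elim: r => [|t r IH].
    under eq_fun do rewrite big_nil.
    by move=> x; apply: cst_continuous.
  under eq_fun do rewrite big_cons.
  case: (ohead t == Some i) => //= x; apply: (continuousD _ (IH x)).
  apply: (continuousM _ (@prod_coord_continuous R n (behead t) x)).
  exact: cst_continuous.
exact: c.
Qed.

Lemma beta_fun_continuous (R : realType) (m n : nat) (A : tensor R m n.+1) :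
  continuous (beta_fun A).
Proof.
rewrite /beta_fun.
have c (i : 'I_n.+1) :
    continuous (fun x : 'rV[R]_n.+1 => x 0 i * tensor_app A x 0 i).
  by move=> x; apply: continuousM; [exact: coord_continuous|exact: tensor_app_continuous].
elim: (index_enum _) => [|i s IH].
  under eq_fun do rewrite big_nil.
  exact: c.
under eq_fun do rewrite big_cons.
by move=> x; exact: (continuous_max (c i x) (IH x)).
Qed.

Lemma beta_dom_nonempty (R : realType) (n : nat) : @beta_dom R n.+1 !=set0.
Proof.
exists (const_mx 1); split; first by move=> i; rewrite mxE.
rewrite [LHS]/Num.norm /= mx_normrE; apply/eqP; rewrite eq_le; apply/andP; split.
  by apply/bigmax_leP; split => // i _; rewrite mxE normr1.
by apply/bigmax_geP; right; exists (ord0, ord0) => //=; rewrite mxE normr1.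
Qed.

Lemma beta_dom_compact (R : realType) (n : nat) : compact (@beta_dom R n).
Proof.
apply: bounded_closed_compact.
  exists 1; split => // r r1 x [_ x1].
  by rewrite /= x1 ltW.
rewrite (_ : @beta_dom R n = (\bigcap_i
    ((fun x : 'rV[R]_n => x 0 i) @^-1` [set y | 0 <= y])) `&`
    ((fun x : 'rV[R]_n => `|x|) @^-1` [set 1])).
  apply: closedI.
    apply: closed_bigI => i _; apply: preimage_closed; last exact: closed_ge.
    by move=> x _; exact: coord_continuous.
  apply: preimage_closed; last exact: closed_eq.
  by move=> x _; exact: norm_continuous.
apply/seteqP; split => x [x0 x1]; split => //.
- by move=> i _; exact: x0.
- by move=> i; exact: x0.
Qed.

Lemma beta_min (R : realType) (m n : nat) (A : tensor R m n.+1) :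
  (exists2 x, @beta_dom R n.+1 x & beta A = beta_fun A x) /\
  (forall x, @beta_dom R n.+1 x -> beta A <= beta_fun A x).
Proof.
have [c] := compact_EVT_min (@beta_dom_nonempty R n) (@beta_dom_compact R n.+1)
  (continuous_subspaceT (@beta_fun_continuous R m n A)).
rewrite inE => cD cmin.
have betaE : beta A = beta_fun A c.
  apply/eqP; rewrite eq_le; apply/andP; split.
    apply: ge_inf; last by exists c.
    by exists (beta_fun A c) => _ [x xD <-]; apply: cmin; rewrite inE.
  apply: lb_le_inf; first by exists (beta_fun A c), c.
  by move=> _ [x xD <-]; apply: cmin; rewrite inE.
split; first by exists c.
by move=> x xD; rewrite betaE; apply: cmin; rewrite inE.
Qed.

(* Main.v *)
Require Import Defs.
From mathcomp Require Import all_boot all_order all_algebra.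
From mathcomp Require Import all_classical all_reals all_analysis.

Set Implicit Arguments.
Unset Strict Implicit.
Unset Printing Implicit Defensive.

Import Order.TTheory GRing.Theory Num.Theory.
Import numFieldNormedType.Exports.

Local Open Scope ring_scope.

(** For [x >= 0], [max_i x_i (A x^(m-1))_i] is positive exactly when a single
    index has [x_i > 0] and [(A x^(m-1))_i > 0]; with [>= 0] in place of [> 0]
    for the second inequality, such an index makes the maximum nonnegative.
    Apply this at a minimizer of [beta]. Conversely, a nonzero [x >= 0] is
    brought into the domain of [beta] by normalization, which preserves the
    signs because [A x^(m-1)] is homogeneous of degree [m-1]. *)

(** Each monomial runs over the tail of an [m]-tuple, so it has [m.-1] factors, each contributing
    one [c]. *)
Lemma tensor_app_scale (R : realType) (m n : nat) (A : tensor R m n) (c : R)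
    (x : 'rV[R]_n) :
  tensor_app A (c *: x) = c ^+ m.-1 *: tensor_app A x.
Proof.
apply/rowP => i; rewrite !mxE mulr_sumr; apply: eq_bigr => t _.
under eq_bigr do rewrite mxE.
rewrite big_split /= big_const_seq count_predT size_behead size_tuple.
by rewrite -Monoid.iteropE mulrCA.
Qed.

(* Unqualified, [beta_fun] is Euler's beta function of MathComp-Analysis. *)
Lemma le_tensor_beta_fun (R : realType) (m n : nat) (A : tensor R m n.+1)
    (x : 'rV[R]_n.+1) (i : 'I_n.+1) :
  x 0 i * tensor_app A x 0 i <= Defs.beta_fun A x.
Proof. exact: le_bigmax. Qed.

Lemma tensor_beta_fun_gt0 (R : realType) (m n : nat) (A : tensor R m n.+1)
    (x : 'rV[R]_n.+1) : vec_ge0 x ->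
  0 < Defs.beta_fun A x <-> exists k, 0 < x 0 k /\ 0 < tensor_app A x 0 k.
Proof.
move=> x0; split=> [|[k [xk Ak]]]; last first.
  exact: lt_le_trans (mulr_gt0 xk Ak) (le_tensor_beta_fun A x k).
have pos i : 0 < x 0 i * tensor_app A x 0 i ->
    exists k, 0 < x 0 k /\ 0 < tensor_app A x 0 k.
  have := x0 i; rewrite le_eqVlt => /predU1P[<-|xi]; first by rewrite mul0r ltxx.
  by rewrite pmulr_rgt0 // => Ai; exists i.
(* The iterated maximum starts from the [ord0] term, so its default value also yields an index. *)
by case/bigmax_gtP => [/pos|[i _ /pos]].
Qed.

Lemma beta_dom_neq0 (R : realType) (n : nat) (x : 'rV[R]_n) :
  beta_dom x -> x != 0.
Proof. by case=> _ x1; rewrite -normr_eq0 x1 oner_eq0. Qed.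

Lemma beta_dom_normalize (R : realType) (n : nat) (x : 'rV[R]_n) :
  vec_ge0 x -> x != 0 -> beta_dom (`|x|^-1 *: x).
Proof.
move=> x0 xN0; split; first by move=> i; rewrite mxE mulr_ge0 ?invr_ge0.
by rewrite normrZ normfV normr_id mulVf ?normr_eq0.
Qed.

Theorem theorem3p2 (R : realType) (m n : nat) (hm : (2 <= m)%N)
    (A : tensor R m n.+1) :
  (strictly_semi_positive A <-> 0 < beta A) /\
  (semi_positive A -> 0 <= beta A).
Proof.
have [[c cD betaE] beta_le] := beta_min A.
have c0 : vec_ge0 c by case: cD.
have cN0 := beta_dom_neq0 cD.
split; [split|].
- by move=> sA; rewrite betaE; apply/tensor_beta_fun_gt0 => //; exact: sA.
- move=> beta_gt0 x x0 xN0.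
  have yD := beta_dom_normalize x0 xN0.
  have /tensor_beta_fun_gt0 := lt_le_trans beta_gt0 (beta_le _ yD).
  case; first by case: yD.
  have ix0 : 0 < `|x|^-1 by rewrite invr_gt0 normr_gt0.
  (* The two quantities at [k] carry positive factors, the inverse norm of [x] and its power [m.-1],
     which drop out. *)
  move=> k; rewrite tensor_app_scale mxE [X in _ /\ 0 < X]mxE.
  by rewrite !pmulr_rgt0 ?exprn_gt0 //; exists k.
- move=> /(_ _ c0 cN0)[k [ck Ak]]; rewrite betaE.
  exact: le_trans (mulr_ge0 (ltW ck) Ak) (le_tensor_beta_fun A c k).
Qed.
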